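(* The signed weighted resolution set is not a complete invariant of (classical) pseudoknots. That is, there exist two pseudodiagrams $P_1$ and $P_2$ of knots that represent distinct pseudoknots (they are not related by any finite sequence of planar isotopies, classical Reidemeister moves and pseudo-Reidemeister moves) but have the same signed weighted resolution set.
   Context: **Pseudodiagrams.** A pseudodiagram of a knot is a planar diagram consisting of a generic immersed closed curve in the plane (finitely many transverse double points, no other singularities). Each double point is either a classical crossing, where over/under information is specified, or a precrossing, where no over/under information is specified. A pseudodiagram in which every double point is a precrossing is called a shadow. **Pseudoknots.** Two pseudodiagrams are equivalent if they are related by a finite sequence of planar isotopies, the classical Reidemeister moves R1, R2, R3 (involving only classical crossings), and the following pseudo-Reidemeister moves: - PR1: adding or removing a kink (a loop bounding an empty disk) whose unique double point is a precrossing. - PR2: if two strands form two consecutive double points bounding an empty bigon (a two-crossing twist), one a precrossing and the other a classical crossing, the order of the two may be exchanged. In braid-like notation, with the strands drawn vertically, $\sigma$ a classical crossing of either type and $p$ a precrossing, $\sigma p \leftrightarrow p\sigma$. This is allowed for all orientations of the strands. - PR3: a strand passing entirely over (or entirely under) the two strands that meet at a precrossing may be slid across that precrossing, remaining entirely over (respectively, under). A pseudoknot is an equivalence class of pseudodiagrams of knots under this relation. Diagrams and knots are taken without a chosen orientation. **Signed weighted resolution set (signed were-set).** A resolution of a pseudodiagram is a classical knot diagram obtained by choosing over/under information at every precrossing, keeping the classical crossings as they are. If $P$ has $n$ precrossings, it has $2^n$ resolutions, all taken to be equally likely (at each precrossing, positive and negative crossings are chosen independently with probability $1/2$ each). The signed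 weighted resolution set of $P$ is the set of ordered pairs $(K,p_K)$ where $K$ ranges over the knot types of resolutions of $P$ and $p_K$ is the probability that a random resolution of $P$ has knot type $K$. A knot and its mirror image are treated as distinct knot types unless they are ambient isotopic. The signed weighted resolution set depends only on the pseudoknot represented by $P$. An invariant is complete if it takes distinct values on distinct pseudoknots. *)

(* Defs.v *)
From HB Require Import structures.
From mathcomp Require Import all_boot all_order all_algebra.
From mathcomp Require Import boolp.
From Stdlib Require Import Relation_Operators.

Set Implicit Arguments.
Unset Strict Implicit.
Unset Printing Implicit Defensive.

(* A pseudodiagram is encoded, up to isotopy of the plane, by the plane graph
   it draws: a combinatorial map (finite set of darts, rotation around the
   vertices, edge involution) of genus 0 with a distinguished outer face.
   The 4-valent vertices are the double points.  There are also 2-valent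
   vertices ("dots"), which only subdivide an arc; they make room for
   crossingless circles and for the crossingless sides of local moves. *)

(* What a dart sees at its vertex: the over or the under strand of a classical
   crossing, a precrossing, or a dot. *)
Inductive strand := Over | Under | Pre | Dot.

Definition strand_encode (s : strand) : bool * bool :=
  match s with
  | Over => (true, true) | Under => (true, false)
  | Pre => (false, true) | Dot => (false, false)
  end.
Definition strand_decode (c : bool * bool) : strand :=
  match c with
  | (true, true) => Over | (true, false) => Under
  | (false, true) => Pre | (false, false) => Dot
  end.
Lemma strand_encodeK : cancel strand_encode strand_decode.
Proof. by case. Qed.
HB.instance Definition _ := Finite.copy strand (can_type strand_encodeK).

Definition flip (s : strand) : strand :=
  match s with Over => Under | Under => Over | Pre => Pre | Dot => Dot end.

(* [vrot] goes to the next dart counterclockwise around the same vertex, [opp]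
   to the other dart of the same edge. The outer face is the one to which
   [outer] belongs; faces are the orbits of [face] below. *)
Record plane_map := PlaneMap {
  dart : finType;
  vrot : dart -> dart;
  opp : dart -> dart;
  mark : dart -> strand;
  outer : dart }.

Definition face (D : plane_map) (d : dart D) : dart D := vrot (opp d).

(* The dart by which the curve leaves the vertex it reaches by [d]. *)
Definition across (D : plane_map) (d : dart D) : dart D :=
  if mark d == Dot then vrot d else vrot (vrot d).

Definition edges_ok (D : plane_map) : bool :=
  [forall d : dart D, (opp (opp d) == d) && (opp d != d)].

Definition vertices_ok (D : plane_map) : bool :=
  [forall d : dart D,
    (mark (vrot d) == flip (mark d)) &&
    (if mark d == Dot then (vrot d != d) && (vrot (vrot d) == d)
     else (vrot (vrot d) != d) && (vrot (vrot (vrot (vrot d))) == d))].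

(* The diagram is the image of a single closed curve, which goes straight
   through double points. In particular the underlying graph is connected. *)
Definition one_curve (D : plane_map) : bool :=
  [forall x : dart D, forall y : dart D,
    connect [rel u v : dart D | (v == opp u) || (v == across u)] x y].

(* Euler's formula, for a connected map. *)
Definition genus0 (D : plane_map) : bool :=
  fcard (@vrot D) (dart D) + fcard (@face D) (dart D)
    == fcard (@opp D) (dart D) + 2.

Definition pseudodiagram (D : plane_map) : bool :=
  [&& edges_ok D, vertices_ok D, one_curve D & genus0 D].

Definition classical_diagram (D : plane_map) : bool :=
  pseudodiagram D && [forall d : dart D, mark d != Pre].

(** Planar isotopy *)

(* Orientation-preserving isomorphism of plane maps, outer face included. *)
Definition map_iso (D E : plane_map) : Prop :=
  exists f : dart D -> dart E,
    [/\ bijective f,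
        {morph f : d / vrot d},
        {morph f : d / opp d},
        forall d, mark (f d) = mark d
      & fconnect (@face E) (f (outer D)) (outer E)].

(* A dot is put on the edge {d, opp d}. *)
Definition subdivide (D : plane_map) (d : dart D) : plane_map :=
  @PlaneMap (dart D + bool)%type
    (fun x => match x with inl e => inl (vrot e) | inr b => inr (~~ b) end)
    (fun x => match x with
      | inl e => if e == d then inr false
                 else if e == opp d then inr true else inl (opp e)
      | inr b => inl (if b then opp d else d)
      end)
    (fun x => match x with inl e => mark e | inr _ => Dot end)
    (inl (outer D)).

(** Tangles and gluing *)

(* A piece of diagram, in a disk or in the complement of a disk, meeting the
   boundary circle in the 2n points 'I_n * bool.  The edge of a dart [d] leads
   either to the dart [tadj d] or to a boundary point; [tleg] is the dart whose
   edge ends at a given boundary point. *)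
Record tangle (n : nat) := Tangle {
  tdart : finType;
  trot : tdart -> tdart;
  tadj : tdart -> tdart + 'I_n * bool;
  tmark : tdart -> strand;
  tleg : 'I_n * bool -> tdart }.

(* The outer face is designated by a dart [r] of the outside [O], hence it is
   never a face contained in the disk filled by [T]. *)
Definition glue (n : nat) (O : tangle n) (r : tdart O) (T : tangle n) : plane_map :=
  @PlaneMap (tdart O + tdart T)%type
    (fun x => match x with inl d => inl (trot d) | inr d => inr (trot d) end)
    (fun x => match x with
      | inl d => match tadj d with inl e => inl e | inr l => inr (tleg T l) end
      | inr d => match tadj d with inl e => inr e | inr l => inl (tleg O l) end
      end)
    (fun x => match x with inl d => tmark d | inr d => tmark d end)
    (inl r).

(* Crossings of two vertical strands: [Classical true] if the strand from
   bottom left to top right is over, [Classical false] if it is under. *)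
Inductive crossing := Classical of bool | Precrossing.

(* The four corners of a crossing, as pairs (right?, top?). *)
Definition ccw (p : bool * bool) : bool * bool :=
  let: (r, t) := p in if r == t then (~~ r, t) else (r, ~~ t).

Definition corner_mark (c : crossing) (p : bool * bool) : strand :=
  match c with
  | Precrossing => Pre
  | Classical b => if (p.1 == p.2) == b then Over else Under
  end.

(* One level of a braid-like tangle on n vertical strands: either no double
   point, or one double point between column i and the next one. *)
Definition level (n : nat) : Type := option ('I_n * crossing).

Definition at_col (n : nat) (i j : 'I_n) : bool := (j == i) || (j == ordS i).

(* The levels are stacked from bottom to top. A dart (t, j, b) is the bottom
   (b = false) or top (b = true) end of column j at level t; a column without
   double point at a level carries a dot. *)
Definition braid_dart (m n : nat) : finType := ('I_m.+1 * 'I_n * bool)%type.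

Definition braid_rot (m n : nat) (w : m.+1.-tuple (level n))
    (x : braid_dart m n) : braid_dart m n :=
  let: (t, j, b) := x in
  match tnth w t with
  | Some (i, _) =>
      if at_col i j then
        let: (r, b') := ccw (j != i, b) in (t, if r then ordS i else i, b')
      else (t, j, ~~ b)
  | None => (t, j, ~~ b)
  end.

Definition braid_mark (m n : nat) (w : m.+1.-tuple (level n))
    (x : braid_dart m n) : strand :=
  let: (t, j, b) := x in
  match tnth w t with
  | Some (i, c) => if at_col i j then corner_mark c (j != i, b) else Dot
  | None => Dot
  end.

(* The boundary points are the bottom and top ends of the columns. *)
Definition braid_adj (m n : nat) (x : braid_dart m n) :
    braid_dart m n + 'I_n * bool :=
  let: (t, j, b) := x in
  if b then (if t == ord_max then inr (j, true) else inl (ordS t, j, false))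
  else (if t == ord0 then inr (j, false) else inl (ord_pred t, j, true)).

Definition braid_leg (m n : nat) (l : 'I_n * bool) : braid_dart m n :=
  let: (j, b) := l in (if b then ord_max else ord0, j, b).

Definition braid (m n : nat) (w : m.+1.-tuple (level n)) : tangle n :=
  Tangle (braid_rot w) (@braid_adj m n) (braid_mark w) (@braid_leg m n).

Definition trivial_braid (n : nat) : tangle n := braid [tuple (None : level n)].

Definition cross1 (n : nat) (c : crossing) : level n.+2 := Some (ord0, c).
Definition cross2 (n : nat) (c : crossing) : level n.+3 := Some (ordS ord0, c).

(* One strand with a curl: a crossing with its two right corners joined. *)
Definition kink (c : crossing) : tangle 1 :=
  @Tangle 1 (bool * bool)%type ccw
    (fun x => let: (r, t) := x in
              if r then inl (true, ~~ t) else inr (ord0, t))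
    (corner_mark c)
    (fun l => (false, l.2)).

(** Moves *)

(* Three strands a, b, c that start in columns 1, 2, 3 and end in columns
   3, 2, 1. X, Y, Z are the crossings of {a,b}, {a,c}, {b,c} respectively. In
   [slide m X Y Z] one strand is entirely over, or entirely under, the two
   others, which meet at the double point m. *)
Inductive slide (m : crossing) : crossing -> crossing -> crossing -> Prop :=
| slide_a (s : bool) : slide m (Classical s) (Classical s) m
| slide_b (s : bool) : slide m (Classical s) m (Classical (~~ s))
| slide_c (s : bool) : slide m m (Classical s) (Classical s).

Definition local_move := forall n : nat, tangle n -> tangle n -> Prop.

Inductive reidemeister : local_move :=
| R1 (s : bool) : reidemeister (kink (Classical s)) (trivial_braid 1)
| R2 (s : bool) :
    reidemeister
      (braid [tuple cross1 0 (Classical s); cross1 0 (Classical (~~ s))])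
      (trivial_braid 2)
| R3 (s : bool) (X Y Z : crossing) : slide (Classical s) X Y Z ->
    reidemeister
      (braid [tuple cross1 1 X; cross2 0 Y; cross1 1 Z])
      (braid [tuple cross2 0 Z; cross1 1 Y; cross2 0 X]).

Inductive pseudo_reidemeister : local_move :=
| PR_classical (n : nat) (T U : tangle n) :
    reidemeister T U -> pseudo_reidemeister T U
| PR1 : pseudo_reidemeister (kink Precrossing) (trivial_braid 1)
| PR2 (s : bool) :
    pseudo_reidemeister
      (braid [tuple cross1 0 (Classical s); cross1 0 Precrossing])
      (braid [tuple cross1 0 Precrossing; cross1 0 (Classical s)])
| PR3 (X Y Z : crossing) : slide Precrossing X Y Z ->
    pseudo_reidemeister
      (braid [tuple cross1 1 X; cross2 0 Y; cross1 1 Z])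
      (braid [tuple cross2 0 Z; cross1 1 Y; cross2 0 X]).

(* A local move replaces the tangle filling a disk. Since both sides have to be
   plane maps, the boundary points of the outside are automatically arranged
   as those of the tangles. *)
Inductive step (R : local_move) : plane_map -> plane_map -> Prop :=
| step_iso (D E : plane_map) :
    pseudodiagram D -> pseudodiagram E -> map_iso D E -> step R D E
| step_subdivide (D : plane_map) (d : dart D) :
    pseudodiagram D -> pseudodiagram (subdivide d) -> step R D (subdivide d)
| step_move (n : nat) (O : tangle n) (r : tdart O) (T U : tangle n) :
    R n T U -> pseudodiagram (glue r T) -> pseudodiagram (glue r U) ->
    step R (glue r T) (glue r U).

Definition same_pseudoknot : plane_map -> plane_map -> Prop :=
  clos_refl_sym_trans plane_map (step pseudo_reidemeister).

Definition same_knot : plane_map -> plane_map -> Prop :=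
  clos_refl_sym_trans plane_map (step reidemeister).

(* Sets of diagrams are plain predicates: the [set] of classical_sets does not
   accept [plane_map], which lives above finType, for universe reasons.

   Knots are taken up to ambient isotopy, that is, by Reidemeister's theorem,
   as classes of classical diagrams. *)
Definition knot_type (D : plane_map) : plane_map -> Prop :=
  fun E => classical_diagram E /\ same_knot D E.

(** Resolutions *)

Definition resolutions (P : plane_map) : {set {ffun dart P -> strand}} :=
  [set r : {ffun dart P -> strand} | [forall d : dart P,
     if mark d == Pre
     then (r d \in [:: Over; Under]) && (r (vrot d) == flip (r d))
     else r d == mark d]].

Definition resolve (P : plane_map) (r : {ffun dart P -> strand}) : plane_map :=
  @PlaneMap (dart P) (@vrot P) (@opp P) r (outer P).

(* Probability that a uniformly random resolution of P has knot type K. *)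
Definition knot_prob (P : plane_map) (K : plane_map -> Prop) : rat :=
  (#|[set r in resolutions P | `[< knot_type (resolve r) = K >]]|%:R
     / #|resolutions P|%:R)%R.

Definition signed_wereset (P : plane_map) : (plane_map -> Prop) * rat -> Prop :=
  fun x => (exists2 r, r \in resolutions P & knot_type (resolve r) = x.1)
           /\ x.2 = knot_prob P x.1.

(* Main.v *)
(** Let D be the standard diagram of the figure-eight knot. Turning a positive
    crossing of D into a precrossing gives P1, turning a negative one into a
    precrossing gives P2. Both have D itself among their two resolutions, and
    the other one is undone by one R2 and two R1 moves, so both signed
    were-sets are {(4_1, 1/2), (unknot, 1/2)}.

    The two are separated by a variant of Fox colorings with values in a field
    containing i with i^2 = -1: in terms of the fraction of a rational tangle,
    a classical crossing has fraction 1 or -1 and a precrossing has fraction i.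
    The determinants of P1 and P2 become 3 + 2 i and 2 + 3 i (up to units). In
    F_13 with i = 5 the first one vanishes and the second one does not, hence
    P1 has a nonconstant coloring and P2 has none. *)

Require Import Defs.
From mathcomp Require Import all_boot all_order all_algebra.
From mathcomp Require Import ring boolp.
From Stdlib Require Import Relation_Operators.
(* [all_algebra] exports another [opp]. *)
Import Defs.

Set Implicit Arguments.
Unset Strict Implicit.
Unset Printing Implicit Defensive.

Import GRing.Theory.

(** * Colorings *)

Section Colorings.

Variables (F : fieldType) (i : F).
Hypothesis i2 : (i * i = -1)%R.

Local Open Scope ring_scope.

(* At a precrossing with corners a, b, c, d in counterclockwise order, the
   relations say c - d = b - a and d - a = i (b - a); they are invariant under
   a quarter turn because i^2 = -1. *)
Definition vcol (X : Type) (rot : X -> X) (mk : X -> strand) (c : X -> F)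
    (d : X) : Prop :=
  match mk d with
  | Over => c (rot (rot d)) = c d /\
            c (rot d) + c (rot (rot (rot d))) = c d + c d
  | Under => True
  | Pre => c (rot (rot d)) = c d + (1 + i) * (c (rot d) - c d) /\
           c (rot (rot (rot d))) = c d + i * (c (rot d) - c d)
  | Dot => c (rot d) = c d
  end.

Lemma vcol_morph (X Y : Type) (rotX : X -> X) (rotY : Y -> Y)
    (mkX : X -> strand) (mkY : Y -> strand) (h : X -> Y) (c : Y -> F) (x : X) :
  (forall x, rotY (h x) = h (rotX x)) -> (forall x, mkY (h x) = mkX x) ->
  vcol rotY mkY c (h x) = vcol rotX mkX (c \o h) x.
Proof. by move=> rotE mkE; rewrite /vcol mkE !rotE. Qed.

Definition coloring (D : plane_map) (c : dart D -> F) : Prop :=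
  forall d : dart D, c (opp d) = c d /\ vcol (@vrot D) (@mark D) c d.

Definition colorable (D : plane_map) : Prop :=
  exists c : dart D -> F, coloring c /\ exists x y, c x <> c y.

(** * Invariance under planar isotopy *)

Lemma colorable_iso (D E : plane_map) : map_iso D E -> colorable E -> colorable D.
Proof.
case=> f [[g fK gK] frot fopp fmark _] [c [cE [x [y cxy]]]].
exists (c \o f); split; last by exists (g x), (g y); rewrite /= !gK.
move=> d; have [cop cv] := cE (f d); split; first by rewrite /= fopp.
by move: cv; rewrite (vcol_morph (rotX := @vrot D) (mkX := @mark D)).
Qed.

(** Injectivity of [face] makes [fconnect] symmetric, which reverses the condition on the outer
    faces. *)
Lemma map_iso_sym (D E : plane_map) :
  injective (@face E) -> map_iso D E -> map_iso E D.
Proof.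
move=> injE [f [[g fK gK] frot fopp fmark fout]].
have grot : {morph g : d / vrot d} by move=> d; rewrite -{1}(gK d) -frot fK.
have gopp : {morph g : d / opp d} by move=> d; rewrite -{1}(gK d) -fopp fK.
exists g; split=> //; first by exists f.
  by move=> d; rewrite -{2}(gK d) fmark.
move: fout; rewrite fconnect_sym // => /iter_findex; set k := findex _ _ _ => Hk.
rewrite -[outer D]fK -Hk.
have gface : forall d, g (face d) = face (g d) by move=> d; rewrite /face grot gopp.
have -> : forall m d, g (iter m (@face E) d) = iter m (@face D) (g d).
  by elim=> [|m IHm] d //=; rewrite gface IHm.
exact: fconnect_iter.
Qed.

Lemma edges_okP (D : plane_map) : edges_ok D ->
  forall d : dart D, opp (opp d) = d /\ opp d != d.
Proof. by move=> /forallP H d; have /andP[/eqP-> ->] := H d. Qed.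

Lemma vertices_okP (D : plane_map) : vertices_ok D ->
  forall d : dart D, vrot (vrot (vrot (vrot d))) = d.
Proof.
move=> /forallP H d; have /andP[/eqP m1 H1] := H d.
move: H1; case: ifP => [/eqP mD /andP[_ /eqP rr] | _ /andP[_ /eqP //]].
by rewrite !rr.
Qed.

Lemma face_inj (D : plane_map) : pseudodiagram D -> injective (@face D).
Proof.
case/and4P=> /edges_okP eD /vertices_okP vD _ _.
apply: inj_comp; last by apply: (can_inj (g := @opp D)) => d; case: (eD d).
by apply: (can_inj (g := fun d => vrot (vrot (vrot d)))) => d; apply: vD.
Qed.

Lemma colorable_subdivide (D : plane_map) (d : dart D) :
  edges_ok D -> colorable D <-> colorable (subdivide d).
Proof.
move=> /edges_okP eD; split=> [[c [cE [x [y cxy]]]] | [c [cE [x [y cxy]]]]].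
  pose c' (x : dart (subdivide d)) := match x with inl e => c e | inr _ => c d end.
  exists c'; split; last by exists (inl x), (inl y).
  case=> [e | b] /=; last by split=> //; case: b => //; case: (cE d).
  split; last by case: (cE e).
  case: eqP => [-> // | _]; case: eqP => [->| _] /=; case: (cE e) => // _ _.
  by case: (cE d).
have cb b : c (inr b) = c (inl d).
  have [] := cE (inl d); rewrite /= eqxx => cf _.
  have [_] := cE (inr true); rewrite /vcol /= cf => ct.
  by case: b; rewrite -?ct ?cf.
have copp : c (inl (opp d)) = c (inl d).
  by have [] := cE (inr true); rewrite /= cb.
exists (fun e => c (inl e)); split.
  move=> e; have [ce cv] := cE (inl e); split=> //.
  move: ce; rewrite /=; case: eqP => [-> _ // | _]; case: eqP => [-> _| //].
  by case: (eD d) => -> _.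
(* The dot has the color of [d], so a coloring that is constant on the old darts is constant. *)
apply: contrapT => cst; case: cxy.
have cstE e : c (inl e) = c (inl d).
  by apply: contrapT => ne; apply: cst; exists e, d.
by case: x => [x|x]; case: y => [y|y]; rewrite ?cb ?cstE.
Qed.

(** * Colorings of tangles *)

Definition tcol (n : nat) (T : tangle n) (c : tdart T -> F) : Prop :=
  forall d, vcol (@trot n T) (@tmark n T) c d /\
            forall e, tadj d = inl e -> c e = c d.

Definition legs_ok (n : nat) (T : tangle n) : Prop :=
  forall (l : 'I_n * bool) (d : tdart T), tadj d = inr l <-> d = tleg T l.

(** Color variation cannot be confined to the inside of the disk. *)
Definition rigid (n : nat) (T : tangle n) : Prop :=
  forall (c : tdart T -> F) (k : F), tcol c -> (forall l, c (tleg T l) = k) ->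
  forall d, c d = k.

Definition recolors (n : nat) (T U : tangle n) : Prop :=
  forall c : tdart T -> F, tcol c ->
  exists2 c' : tdart U -> F, tcol c' & forall l, c' (tleg U l) = c (tleg T l).

(** The colors outside are kept and [recolors] extends them over [U]. If the result were constant,
    [c] would be constant outside and on the legs of [T], hence also on [T] by rigidity. *)
Lemma colorable_glue (n : nat) (O T U : tangle n) (r : tdart O) :
  legs_ok T -> legs_ok U -> rigid T -> recolors T U ->
  colorable (glue r T) -> colorable (glue r U).
Proof.
move=> lT lU rT TU [c [cE [x [y cxy]]]].
have cT : tcol (fun d => c (inr d)).
  move=> d; have [ce cv] := cE (inr d); split=> // e de.
  by move: ce; rewrite /= de.
have [c' c'E c'l] := TU _ cT.
have legT l : c (inl (tleg O l)) = c (inr (tleg T l)).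
  by have [] := cE (inr (tleg T l)); rewrite /= (proj2 (lT l _) erefl).
pose c2 (x : dart (glue r U)) := match x with inl d => c (inl d) | inr d => c' d end.
exists c2; split.
  case=> d /=.
    have [ce cv] := cE (inl d); split=> //.
    move: ce; rewrite /=; case: (tadj d) => [e|l] //= <-.
    exact: c'l.
  have [cv ce] := c'E d; split=> //.
  case dl: (tadj d) => [e|l] /=; first exact: ce.
  by rewrite legT -c'l -(proj1 (lU l d) dl).
apply: contrapT => cst; case: cxy; pose k := c (inl r).
have cst' z : c2 z = k.
  by apply: contrapT => ne; apply: cst; exists z, (inl r).
have cTk d : c (inr d) = k.
  by apply: (rT _ _ cT) => l; rewrite -c'l; apply: (cst' (inr _)).
by case: x => x; case: y => y;
  rewrite ?cTk ?(cst' (inl _)) -?[c (inl _)]/(c2 (inl _)) ?cst'.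
Qed.

(* The colors (top left, top right) forced by (bottom left, bottom right). *)
Definition xact (x : crossing) (a b : F) : F * F :=
  match x with
  | Classical true => (a + a - b, a)
  | Classical false => (b, b + b - a)
  | Precrossing => (a + i * (b - a), a + (1 + i) * (b - a))
  end.

(** A crossing acts as a transfer map from bottom to top. With [d = b - a], it adds [- d], [d] or
    [i * d] to both colors, for [Classical true], [Classical false] and [Precrossing] respectively,
    and so preserves [d]. *)
Lemma crossing_col (x : crossing) (q : bool * bool -> F) :
  (forall p, vcol ccw (corner_mark x) q p) <->
  (q (false, true), q (true, true)) = xact x (q (false, false)) (q (true, false)).
Proof.
split=> [H|].
  case: x H => [[]|] H /=.
  - by have [/= -> <-] := H (false, false); congr pair; ring.
  - by have [/= -> <-] := H (true, false); congr pair; ring.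
  - by have [/= -> ->] := H (false, false).
case: x => [[]|] /= [e1 e2] [[] []]; rewrite /vcol /= ?e1 ?e2 //.
- by split=> //; ring.
- by split=> //; ring.
- by split=> //; ring.
- by split=> //; ring.
- split; last by ring: i2.
  by ring: i2.
- split; by ring: i2.
- split; by ring: i2.
Qed.

Lemma xact_cst (x : crossing) (k : F) : xact x k k = (k, k).
Proof. by case: x => [[]|] /=; congr pair; ring. Qed.

Definition lact (n : nat) (v : 'I_n -> F) (lv : level n) : 'I_n -> F :=
  match lv with
  | None => v
  | Some (j, x) => fun k => let q := xact x (v j) (v (ordS j)) in
      if k == j then q.1 else if k == ordS j then q.2 else v k
  end.

(** [ordS] is cyclic: with a single column, a double point would join that column to itself. *)
Definition level_ok (n : nat) (lv : level n) : bool :=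
  if lv is Some (j, _) then ordS j != j else true.

(** * Colorings of braid-like tangles *)

Section Braids.

Variables (m n : nat) (w : m.+1.-tuple (level n)).
Hypothesis w_ok : all (@level_ok n) w.

Lemma level_col (c : braid_dart m n -> F) (t : 'I_m.+1) :
  (forall j b, vcol (braid_rot w) (braid_mark w) c (t, j, b)) <->
  forall j, c (t, j, true) = lact (fun j => c (t, j, false)) (tnth w t) j.
Proof.
have := all_tnthP w_ok t; case wt: (tnth w t) => [[k x]|] /=; last first.
  move=> _; split=> [H j | H j b].
    by have := H j false; rewrite /vcol /= wt.
  by rewrite /vcol /= wt; case: b; rewrite /= H.
(* [h] places the four corners of the model crossing at level [t], compatibly with rotation and
   marks, so that [crossing_col] applies; the other columns carry dots. *)
move=> kS; pose h (p : bool * bool) := (t, if p.1 then ordS k else k, p.2).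
have hrot p : braid_rot w (h p) = h (ccw p).
  rewrite /h /= wt; case: p => [[] b] /=; rewrite /at_col !eqxx ?orbT /=.
    by rewrite kS; case: b.
  by case: b.
have hmark p : braid_mark w (h p) = corner_mark x p.
  rewrite /h /= wt; case: p => [[] b] /=; rewrite /at_col !eqxx ?orbT //=.
  by rewrite kS.
have hcol := crossing_col x (c \o h).
split=> [H j | H].
  have hx : forall p, vcol ccw (corner_mark x) (c \o h) p.
    by move=> p; rewrite -(vcol_morph _ _ hrot hmark); apply: H.
  have {hcol hx} := proj1 hcol hx; rewrite /h /= => <- /=.
  have [-> // | jk] := eqVneq j k; have [-> // | jS] := eqVneq j (ordS k).
  by have := H j false; rewrite /vcol /= wt /at_col (negPf jk) (negPf jS).
have {hcol} Hh : forall p, vcol ccw (corner_mark x) (c \o h) p.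
  by apply/hcol; rewrite /h /= !H (negPf kS) !eqxx -surjective_pairing.
move=> j b; have [-> | jk] := eqVneq j k.
  by have := Hh (false, b); rewrite -(vcol_morph _ _ hrot hmark).
have [-> | jS] := eqVneq j (ordS k).
  by have := Hh (true, b); rewrite -(vcol_morph _ _ hrot hmark).
rewrite /vcol /= wt /at_col (negPf jk) (negPf jS) /=.
by case: b => /=; rewrite H (negPf jk) (negPf jS).
Qed.

Definition state (v : 'I_n -> F) (t : nat) : 'I_n -> F :=
  foldl (@lact n) v (take t w).

Lemma stateS (v : 'I_n -> F) (t : 'I_m.+1) :
  state v t.+1 = lact (state v t) (tnth w t).
Proof.
rewrite /state (take_nth None) ?size_tuple ?ltn_ord // foldl_rcons.
by rewrite -tnth_nth.
Qed.

(** Colors propagate upwards from the bottom ends. Level [t] leads from height [t] to height [t.+1],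
    so the dart [(t, j, b)] lies at height [t + b]. *)
Lemma tcol_state (c : braid_dart m n -> F) : tcol (T := braid w) c ->
  forall t j b, c (t, j, b) = state (fun j => c (ord0, j, false)) (t + b) j.
Proof.
move=> cE; set v := fun j => _.
have lev t j : c (t, j, true) = lact (fun j => c (t, j, false)) (tnth w t) j.
  by move: j; apply/level_col => j b; case: (cE (t, j, b)).
suff bot k (t : 'I_m.+1) : t = k :> nat -> (fun j => c (t, j, false)) = state v t.
  move=> t j [].
    by rewrite lev (bot t t) // addn1 stateS.
  by rewrite addn0 -(bot t t).
elim: k t => [|k IHk] t tk.
  by rewrite tk /state take0; apply: funext => j; congr (c (_, _, _)); apply: val_inj.
have kt : (k < m.+1)%N by rewrite -ltnS -tk ltnS ltnW.
rewrite tk (stateS v (Ordinal kt)) -(IHk (Ordinal kt)) //; apply: funext => j.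
have [_ cadj] := cE (Ordinal kt, j, true).
rewrite -lev; apply: cadj => /=; case: eqP => [/(congr1 val) /= km | _].
  by have := ltn_ord t; rewrite tk km ltnn.
congr (inl (_, _, _)); apply: val_inj => /=.
by rewrite modn_small -?tk.
Qed.

Definition braid_col (v : 'I_n -> F) (x : braid_dart m n) : F :=
  let: (t, j, b) := x in state v (t + b) j.

Lemma braid_col_tcol (v : 'I_n -> F) : tcol (T := braid w) (braid_col v).
Proof.
case=> [[t j] b]; split.
  apply: (iffRL (level_col _ t)); move=> k.
  by rewrite /= addn1 stateS; congr (lact _ _ _); apply: funext => l; rewrite addn0.
case=> [[t' j'] b'] /=; case: b.
  case: eqP => // /eqP tm [<- <- <-] /=; rewrite modn_small ?addn0 ?addn1 //.
  by rewrite ltnS ltn_neqAle tm -ltnS ltn_ord.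
case: eqP => // /eqP t0 [<- <- <-] /=; rewrite addn0 addn1.
case: t t0 => [[|t] lt_t] // _ /=.
by rewrite modnDr modn_small // ltnW.
Qed.

Lemma braid_legs_ok : legs_ok (braid w).
Proof.
case=> j b [[t k] b'] /=; split.
  by case: b'; case: eqP => // -> [-> <-].
by case=> -> -> ->; case: b; rewrite eqxx.
Qed.

Lemma braid_rigid : rigid (braid w).
Proof.
move=> c k cE cl [[t j] b]; rewrite (tcol_state cE).
have -> : (fun j => c (ord0, j, false)) = fun=> k.
  by apply: funext => l; apply: (cl (l, false)).
rewrite /state; elim: (take _ _) => //= lv s IHs.
suff -> : lact (fun=> k) lv = fun=> k by [].
apply: funext => l; case: lv => [[a x]|] //=; rewrite xact_cst /=.
by case: ifP => _ //; case: ifP.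
Qed.

Lemma state_top (v : 'I_n -> F) : state v m.+1 = foldl (@lact n) v w.
Proof. by rewrite /state take_oversize // size_tuple. Qed.

End Braids.

(** The bottom colors can be chosen freely and determine the others, so only the top colors have to
    be compared. *)
Lemma braid_recolors (m m' n : nat) (w : m.+1.-tuple (level n))
    (w' : m'.+1.-tuple (level n)) :
  all (@level_ok n) w -> all (@level_ok n) w' ->
  (forall v, foldl (@lact n) v w =1 foldl (@lact n) v w') ->
  recolors (braid w) (braid w').
Proof.
move=> w_ok w'_ok ww' c cE; set v := fun j => c (ord0, j, false).
exists (braid_col w' v); first exact: braid_col_tcol.
case=> j [] /=; last by rewrite addn0 /state take0.
by rewrite (tcol_state w_ok cE) /= !addn1 !state_top ww'.
Qed.

(** * Colorings of a kink *)

Lemma i_neq0 : i != 0.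
Proof.
apply/eqP => i0; have /eqP := i2; rewrite i0 mul0r eq_sym oppr_eq0.
by rewrite oner_eq0.
Qed.

(** Let [a], [b] be the bottom colors. Joining the right corners forces the shift [s * (b - a)] to
    vanish, where [s] is [-1], [1] or [i]; since [s] is nonzero, [a = b]. *)
Lemma kink_cst (x : crossing) (c : tdart (kink x) -> F) :
  tcol c <-> forall d, c d = c (false, false).
Proof.
split=> [cE | cst].
  have e3 : c (true, true) = c (true, false).
    by have [_ H] := cE (true, false); apply: H.
  have xE := proj1 (crossing_col x c) (fun p => let: conj h _ := cE p in h).
  rewrite e3 in xE.
  suff e1 : c (true, false) = c (false, false).
    move: xE; rewrite e1 xact_cst => -[e2].
    by move=> [[] []]; rewrite ?e3 ?e1 ?e2.
  case: x c {cE e3} xE => [[]|] c /= [_] // /eqP; rewrite -subr_eq0 => /eqP e;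
    apply/eqP; rewrite -subr_eq0.
    by rewrite -oppr_eq0 -e; apply/eqP; ring.
  suff : i * (c (true, false) - c (false, false)) = 0.
    by move/eqP; rewrite mulf_eq0 (negPf i_neq0).
  by rewrite -oppr0 -e; ring.
move=> d; split; last by move=> e _; rewrite !cst.
move: d; apply/crossing_col; rewrite !(cst (_, true)) (cst (true, _)).
by rewrite xact_cst.
Qed.

Lemma kink_legs_ok (x : crossing) : legs_ok (kink x).
Proof.
case=> j b [[] t] /=; first by split.
by rewrite (ord1 j); split=> [[->] | [->]].
Qed.

Lemma kink_rigid (x : crossing) : rigid (kink x).
Proof. by move=> c k /kink_cst cE cl d; rewrite cE (cl (ord0, false)). Qed.

Lemma kink_recolors (x : crossing) : recolors (kink x) (trivial_braid 1).
Proof.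
move=> c /kink_cst cE; pose v := fun _ : 'I_1 => c (false, false).
exists (braid_col [tuple None] v); first exact: braid_col_tcol.
by case=> j b; rewrite cE; case: b.
Qed.

Lemma recolors_kink (x : crossing) : recolors (trivial_braid 1) (kink x).
Proof.
move=> c cE; exists (fun=> c (ord0, ord0, false)); first exact/kink_cst.
have trivial_ok : all (@level_ok 1) [tuple None] by [].
by case=> j [] /=; rewrite [RHS](tcol_state trivial_ok cE) (ord1 j) ?addn1 ?addn0.
Qed.

(** A sliding strand of color [k] that is over reflects the two others by [z -> 2 k - z], and the
    relations at the double point [x] are affine. If it is under, its color changes by twice the
    difference of the two colors it meets, which is the same on both sides of [x]. Taking [x]
    classical gives R3, and a precrossing gives PR3. *)
Lemma slide_lact (x X Y Z : crossing) : slide x X Y Z ->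
  forall v : 'I_3 -> F,
  foldl (@lact 3) v [:: cross1 1 X; cross2 0 Y; cross1 1 Z] =1
  foldl (@lact 3) v [:: cross2 0 Z; cross1 1 Y; cross2 0 X].
Proof.
have o2 : ordS ord0 = inord 1 :> 'I_3 by apply: val_inj; rewrite /= inordK.
have o3 : ordS (inord 1) = inord 2 :> 'I_3 by apply: val_inj; rewrite /= !inordK.
have o10 : (inord 1 == ord0 :> 'I_3) = false by rewrite -val_eqE /= inordK.
have o20 : (inord 2 == ord0 :> 'I_3) = false by rewrite -val_eqE /= inordK.
have o21 : (inord 2 == inord 1 :> 'I_3) = false by rewrite -val_eqE /= !inordK.
have o12 : (inord 1 == inord 2 :> 'I_3) = false by rewrite eq_sym.
have o01 : (ord0 == inord 1 :> 'I_3) = false by rewrite eq_sym.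
have o02 : (ord0 == inord 2 :> 'I_3) = false by rewrite eq_sym.
move=> sl v j.
have {sl} : [\/ j = ord0, j = inord 1 | j = inord 2] /\ slide x X Y Z.
  split=> //; case: j => [[|[|[|//]]] lt_j].
  - by apply: Or31; apply: val_inj.
  - by apply: Or32; apply: val_inj; rewrite /= inordK.
  - by apply: Or33; apply: val_inj; rewrite /= inordK.
case=> jE; case=> s; case: x s => [[]|] []; rewrite /= !o2 !o3;
  case: jE => ->; rewrite ?eqxx ?o10 ?o20 ?o21 ?o12 ?o01 ?o02 /=;
  by ring: i2.
Qed.

Definition color_move (n : nat) (T U : tangle n) : Prop :=
  [/\ legs_ok T /\ legs_ok U, rigid T /\ rigid U & recolors T U /\ recolors U T].

Lemma braid_color_move (m m' n : nat) (w : m.+1.-tuple (level n))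
    (w' : m'.+1.-tuple (level n)) :
  all (@level_ok n) w -> all (@level_ok n) w' ->
  (forall v, foldl (@lact n) v w =1 foldl (@lact n) v w') ->
  color_move (braid w) (braid w').
Proof.
move=> w_ok w'_ok ww'; split; split; try exact: braid_legs_ok;
  try exact: braid_rigid; apply: braid_recolors => // v j; by rewrite ww'.
Qed.

Lemma kink_color_move (x : crossing) : color_move (kink x) (trivial_braid 1).
Proof.
split; split; [exact: kink_legs_ok | exact: braid_legs_ok | exact: kink_rigid
  | exact: braid_rigid | exact: kink_recolors | exact: recolors_kink].
Qed.

(** For R2 and PR2, crossings of the same two strands shift both colors by multiples of their
    preserved difference: opposite shifts cancel, and any two shifts commute. *)
Lemma pseudo_reidemeister_color_move (n : nat) (T U : tangle n) :
  pseudo_reidemeister T U -> color_move T U.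
Proof.
have ord2 (j : 'I_2) : j = ord0 \/ j = ordS ord0.
  by case: j => [[|[|//]] lt_j]; [left | right]; apply: val_inj.
have S2 : ordS (ord0 : 'I_2) == ord0 = false by [].
case=> {n T U} [n T U [s | s | s X Y Z sl] | | s | X Y Z sl].
- exact: kink_color_move.
- apply: braid_color_move => // v j.
  by case: s; case: (ord2 j) => ->; rewrite /= ?S2 ?eqxx /=; ring.
- by apply: braid_color_move => //; apply: slide_lact sl.
- exact: kink_color_move.
- apply: braid_color_move => // v j.
  by case: s; case: (ord2 j) => ->; rewrite /= ?S2 ?eqxx /=; ring: i2.
- by apply: braid_color_move => //; apply: slide_lact sl.
Qed.

Lemma colorable_step (D E : plane_map) :
  step pseudo_reidemeister D E -> colorable D <-> colorable E.
Proof.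
case=> {D E} [D E pD pE DE | D d pD _ | n O r T U TU _ _].
- split; apply: colorable_iso => //; apply: map_iso_sym => //; exact: face_inj.
- by apply: colorable_subdivide; case/and4P: pD.
- have [[lT lU] [rT rU] [TU' UT']] := pseudo_reidemeister_color_move TU.
  by split; apply: colorable_glue.
Qed.

Lemma colorable_pseudoknot (D E : plane_map) :
  same_pseudoknot D E -> colorable D <-> colorable E.
Proof.
by elim=> [? ? /colorable_step | | ? ? _ [] | ? ? ? _ [? ?] _ [? ?]] //; tauto.
Qed.

End Colorings.

(** * Checking explicit diagrams *)

(* The enumeration of a finType does not compute, hence the explicit lists of
   darts below. *)
Section Certificates.

Definition enumerates (T : eqType) (s : seq T) : Prop := forall x, x \in s.

Fixpoint walk (T : eqType) (f : T -> T) (x y : T) (k : nat) : seq T :=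
  if k is k'.+1 then if y == x then [::] else y :: walk f x (f y) k' else [::].

(** Proposes a list of orbits, with [k] as fuel for each of them; [orbits_ok] certifies it. *)
Fixpoint orbits (T : eqType) (f : T -> T) (k : nat) (s : seq T) : seq (seq T) :=
  if s is x :: s' then
    let os := orbits f k s' in
    if x \in flatten os then os else (x :: walk f x (f x) k) :: os
  else [::].

Definition orbits_ok (T : eqType) (f : T -> T) (s : seq T) (os : seq (seq T)) : bool :=
  [&& all (fun o => (o != [::]) && fcycle f o) os, uniq (flatten os)
    & all (mem (flatten os)) s].

(** [fcard] counts the roots of the orbits, and each listed cycle contains exactly one: the root of
    its first element. *)
Lemma fcard_orbits (T : finType) (f : T -> T) (s : seq T) (os : seq (seq T)) :
  injective f -> enumerates s -> orbits_ok f s os -> fcard f T = size os.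
Proof.
move=> injf sT /and3P[osc osu /allP ss].
have perm_os : perm_eq (enum T) (flatten os).
  apply: uniq_perm => //; first exact: enum_uniq.
  by move=> x; rewrite mem_enum inE; apply/esym/ss.
have -> : fcard f T = count (froots f) (flatten os).
  rewrite -(permP perm_os) -size_filter /n_comp_mem cardE; congr size.
  by rewrite {1}/enum_mem /enum_mem -filter_predI; apply: eq_filter => x.
have fsym := fconnect_sym injf.
rewrite count_flatten; elim: os osc osu {perm_os ss} => [|o os IHos] //=.
move=> /andP[/andP[o0 oc] osc]; rewrite cat_uniq => /and3P[ou _ osu].
rewrite IHos // -add1n; congr (_ + _); case: o o0 oc ou => // x0 o _ oc ou.
have rootE x : x \in x0 :: o -> froots f x = (froot f x0 == x).
  move=> xo; rewrite /roots /=; congr (_ == x); apply/esym.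
  by apply/(fingraph.rootP fsym); rewrite (fconnect_cycle oc) ?mem_head.
rewrite (eq_in_count (a2 := pred1 (froot f x0))); last first.
  by move=> x xo; rewrite rootE //= eq_sym.
rewrite count_uniq_mem // -(fconnect_cycle oc (mem_head _ _)).
by rewrite connect_root.
Qed.

Variables (D : plane_map) (s : seq (dart D)).
Hypothesis sD : enumerates s.

(** Follows the curve along [k] edges and lists both ends of each; with [k] half the number of
    darts, one closed tour can visit them all. *)
Fixpoint tour (x : dart D) (k : nat) : seq (dart D) :=
  if k is k'.+1 then [:: x, opp x & tour (across (opp x)) k'] else [::].

Definition dart_ok (d : dart D) : bool :=
  [&& opp (opp d) == d, opp d != d, mark (vrot d) == flip (mark d)
    & if mark d == Dot then (vrot d != d) && (vrot (vrot d) == d)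
      else (vrot (vrot d) != d) && (vrot (vrot (vrot (vrot d))) == d)].

Definition pseudodiagram_check : bool :=
  let orbs f := orbits f (size s) s in
  let t := tour (outer D) (size s)./2 in
  [&& all dart_ok s,
      all (mem t) s,
      cycle [rel u v : dart D | (v == opp u) || (v == across u)] t,
      orbits_ok (@vrot D) s (orbs (@vrot D)),
      orbits_ok (@opp D) s (orbs (@opp D)),
      orbits_ok (@face D) s (orbs (@face D))
    & size (orbs (@vrot D)) + size (orbs (@face D))
        == size (orbs (@opp D)) + 2].

Lemma pseudodiagramP : pseudodiagram_check -> pseudodiagram D.
Proof.
case/and5P=> /allP ok /allP tD tc ov /and3P[oo of_ euler].
have eD : edges_ok D.
  by apply/forallP => d; case/and4P: (ok d (sD d)) => -> ->.
have vD : vertices_ok D.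
  by apply/forallP => d; case/and4P: (ok d (sD d)) => _ _ -> ->.
have injo : injective (@opp D).
  by apply: (can_inj (g := @opp D)) => d; case: (edges_okP eD d).
have injv : injective (@vrot D).
  by apply: (can_inj (g := fun d => vrot (vrot (vrot d)))); apply: vertices_okP.
have injf : injective (@face D) by apply: inj_comp.
rewrite /pseudodiagram eD vD /=; apply/andP; split.
  by apply/forallP => x; apply/forallP => y; apply: (connect_cycle tc); apply: tD.
by rewrite /genus0 (fcard_orbits injv sD ov) (fcard_orbits injf sD of_)
  (fcard_orbits injo sD oo).
Qed.

Variables (E : plane_map) (u : seq (dart E)) (p : seq nat).
Hypothesis uE : enumerates u.

(** [p] lists, in the order of [s], the positions in [u] of the images. *)
Definition relabel (d : dart D) : dart E := nth (outer E) u (nth 0 p (index d s)).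
Definition unlabel (e : dart E) : dart D :=
  nth (outer D) s (index e (map relabel s)).

Definition map_iso_check : bool :=
  [&& all (fun d => [&& unlabel (relabel d) == d,
             relabel (vrot d) == vrot (relabel d),
             relabel (opp d) == opp (relabel d) & mark (relabel d) == mark d]) s,
      all (fun e => relabel (unlabel e) == e) u
    & has (fun k => iter k (@face E) (relabel (outer D)) == outer E)
        (iota 0 (size u))].

Lemma map_isoP : map_iso_check -> map_iso D E.
Proof.
case/and3P=> /allP ds /allP us /hasP[k _ /eqP ko]; exists relabel.
have dP d := and4P (ds d (sD d)).
split; [exists unlabel | | | | rewrite -ko; exact: fconnect_iter] => d.
- by have [/eqP] := dP d.
- by apply/eqP/us.
- by have [_ /eqP] := dP d.
- by have [_ _ /eqP] := dP d.
- by have [_ _ _ /eqP] := dP d.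
Qed.

End Certificates.

Lemma same_knot_iso (D E : plane_map) (s : seq (dart D)) (u : seq (dart E))
    (p : seq nat) :
  enumerates s -> enumerates u -> pseudodiagram_check s ->
  pseudodiagram_check u -> map_iso_check s u p -> same_knot D E.
Proof.
move=> sD uE Ds Eu DE; apply: rst_step; apply: step_iso.
- exact: (pseudodiagramP sD).
- exact: (pseudodiagramP uE).
- exact: (map_isoP sD uE DE).
Qed.

Lemma same_knot_subdivide (D : plane_map) (d : dart D) (s : seq (dart D))
    (u : seq (dart (subdivide d))) :
  enumerates s -> enumerates u -> pseudodiagram_check s ->
  pseudodiagram_check u -> same_knot (subdivide d) D.
Proof.
move=> sD uE Ds Eu; apply: rst_sym; apply: rst_step; apply: step_subdivide.
- exact: (pseudodiagramP sD).
- exact: (pseudodiagramP uE).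
Qed.

Lemma same_knot_move (n : nat) (O T U : tangle n) (r : tdart O)
    (s : seq (dart (glue r T))) (u : seq (dart (glue r U))) :
  enumerates s -> enumerates u -> reidemeister T U -> pseudodiagram_check s ->
  pseudodiagram_check u -> same_knot (glue r T) (glue r U).
Proof.
move=> sD uE TU Ds Eu; apply: rst_step; apply: step_move => //.
- exact: (pseudodiagramP sD).
- exact: (pseudodiagramP uE).
Qed.

(** * Explicit lists of darts *)

Definition ords (n : nat) : seq 'I_n.+1 := [seq inZp k | k <- iota 0 n.+1].

Lemma ords_enum (n : nat) : enumerates (ords n).
Proof.
move=> x; apply/mapP; exists (val x); last by rewrite valZpK.
by rewrite mem_iota add0n ltn_ord.
Qed.

Definition sums (A B : eqType) (s : seq A) (t : seq B) : seq (A + B) :=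
  map inl s ++ map inr t.

Lemma sums_enum (A B : eqType) (s : seq A) (t : seq B) :
  enumerates s -> enumerates t -> enumerates (sums s t).
Proof.
by move=> sA tB [x|x]; rewrite mem_cat map_f ?orbT.
Qed.

Definition pairs (A B : eqType) (s : seq A) (t : seq B) : seq (A * B) :=
  allpairs pair s t.

Lemma pairs_enum (A B : eqType) (s : seq A) (t : seq B) :
  enumerates s -> enumerates t -> enumerates (pairs s t).
Proof. by move=> sA tB [x y]; apply: allpairs_f. Qed.

Definition bools : seq bool := [:: false; true].

Lemma bools_enum : enumerates bools. Proof. by case. Qed.

Definition braid_darts (m n : nat) : seq (braid_dart m n.+1) :=
  pairs (pairs (ords m) (ords n)) bools.

Lemma braid_darts_enum (m n : nat) : enumerates (braid_darts m n).
Proof.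
apply: pairs_enum bools_enum; apply: pairs_enum; exact: ords_enum.
Qed.

Definition kink_darts : seq (bool * bool) := pairs bools bools.

Lemma kink_darts_enum : enumerates kink_darts.
Proof. exact: pairs_enum bools_enum bools_enum. Qed.

(** * Resolutions *)

Lemma knot_type_eq (D E : plane_map) : same_knot D E -> knot_type D = knot_type E.
Proof.
move=> DE; apply: funext => K; apply: propext; split=> -[cK kK]; split=> //.
  exact: rst_trans (rst_sym _ _ _ _ DE) kK.
exact: rst_trans DE kK.
Qed.

(** The number of resolutions of type [K] is a sum of two truth values, which covers both equal and
    distinct knot types of [a] and [b]. *)
Lemma signed_wereset_pair (P Q : plane_map) (a b : {ffun dart P -> strand})
    (c d : {ffun dart Q -> strand}) :
  resolutions P = [set a; b] -> a != b -> resolutions Q = [set c; d] -> c != d ->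
  knot_type (resolve a) = knot_type (resolve c) ->
  knot_type (resolve b) = knot_type (resolve d) ->
  signed_wereset P = signed_wereset Q.
Proof.
move=> Pab ab Qcd cd ac bd.
have prob K : knot_prob P K = knot_prob Q K.
  have card2 (D : plane_map) (x y : {ffun dart D -> strand})
      (f : {ffun dart D -> strand} -> bool) :
      x != y -> #|[set r in [set x; y] | f r]| = f x + f y.
    move=> xy; rewrite -sum1_card (eq_bigl (fun r => (r \in [set x; y]) && f r)).
      rewrite big_mkcondr big_setU1 ?inE //= big_set1.
      by case: (f x); case: (f y).
    by move=> r; rewrite inE.
  by rewrite /knot_prob Pab Qcd !card2 // !cards2 ab cd ac bd.
apply: funext => -[K q]; apply: propext; rewrite /signed_wereset /= prob Pab Qcd.
split=> -[[r]]; rewrite !inE => /orP[] /eqP -> <- ->; split=> //.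
- by exists c; rewrite ?inE ?eqxx ?ac.
- by exists d; rewrite ?inE ?eqxx ?orbT ?bd.
- by exists a; rewrite ?inE ?eqxx ?ac.
- by exists b; rewrite ?inE ?eqxx ?orbT ?bd.
Qed.

(** * Diagrams with one precrossing *)

Section SinglePrecrossing.

Variables (P : plane_map) (p : dart P).

Definition turns : seq (dart P) := traject (@vrot P) p 4.

Definition set_mark (s : strand) (d : dart P) : strand :=
  if mark d == Pre then iter (index d turns) flip s else mark d.

Definition set_mark_ok (s : strand) (d : dart P) : bool :=
  if mark d == Pre
  then (set_mark s d \in [:: Over; Under]) &&
       (set_mark s (vrot d) == flip (set_mark s d))
  else set_mark s d == mark d.

Definition single_pre_check (s : seq (dart P)) : bool :=
  [&& all (fun d => (mark d == Pre) == (d \in turns)) s,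
      all (set_mark_ok Over) s & all (set_mark_ok Under) s].

(** Marks flip at each quarter turn, so the mark at [p] determines a resolution at the four darts of
    the precrossing; elsewhere it agrees with [mark]. *)
Lemma resolutions_single (s : seq (dart P)) :
  enumerates s -> single_pre_check s ->
  resolutions P = [set finfun (set_mark Over); finfun (set_mark Under)].
Proof.
move=> sP /and3P[/allP pre /allP okO /allP okU].
have preE d : (mark d == Pre) = (d \in turns) by exact: eqP (pre d (sP d)).
apply/setP => r; rewrite !inE; apply/forallP/orP => [H | rE d]; last first.
  have okr b : set_mark_ok b d -> r = finfun (set_mark b) ->
    if mark d == Pre
    then (r d \in [:: Over; Under]) && (r (vrot d) == flip (r d))
    else r d == mark d by move=> ok ->; rewrite !ffunE.
  by case: rE => /eqP rE; apply: okr rE; [apply: okO | apply: okU]; apply: sP.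
have rp : r p \in [:: Over; Under].
  by have := H p; rewrite preE mem_head => /andP[].
suff rE : r = finfun (set_mark (r p)).
  by move: rp; rewrite rE !inE -rE => /orP[] /eqP <-; [left | right]; rewrite -rE.
apply/ffunP => d; rewrite ffunE /set_mark.
have := H d; rewrite preE; case: ifP => [dt _ | _ /eqP //].
have iterE k : k < 4 -> r (iter k (@vrot P) p) = iter k flip (r p).
  elim: k => // k IHk k4; rewrite !iterS -IHk; last exact: ltnW.
  have := H (iter k (@vrot P) p); rewrite preE.
  have -> : iter k (@vrot P) p \in turns by apply/trajectP; exists k => //; apply: ltnW.
  by case/andP => _ /eqP.
have dk : index d turns < 4 by rewrite -[4](size_traject (@vrot P) p) index_mem.
by rewrite -{1}(nth_index p dt) nth_traject // iterE.
Qed.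

Lemma set_mark_neq : mark p = Pre ->
  finfun (set_mark Over) != finfun (set_mark Under) :> {ffun dart P -> strand}.
Proof.
move=> pP; apply/eqP => /ffunP/(_ p).
by rewrite !ffunE /set_mark pP /turns /= eqxx.
Qed.

End SinglePrecrossing.

(** Keeps the marks as a plain function, so that the checks can compute them. *)
Definition remark (P : plane_map) (f : dart P -> strand) : plane_map :=
  PlaneMap (@vrot P) (@opp P) f (outer P).

Lemma resolve_finfun (P : plane_map) (f : dart P -> strand) :
  resolve (finfun f) = remark f.
Proof.
by rewrite /resolve /remark; congr PlaneMap; apply: funext => d; rewrite ffunE.
Qed.

(** * The figure-eight knot *)

(* The standard diagram of the figure-eight knot: dart 4 v + k is the k-th end,
   counterclockwise from the incoming under end, at the v-th crossing of the
   planar diagram code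
     X[4,2,5,1] X[8,6,1,5] X[6,3,7,4] X[2,7,3,8],
   the crossing number v being replaced with a precrossing. *)
Definition fig8 (v : nat) : plane_map :=
  @PlaneMap 'I_16
    (fun d => inZp (4 * (d %/ 4) + d.+1 %% 4))
    (fun d => inZp (nth 0 [:: 11; 12; 7; 6; 15; 8; 3; 2; 5; 14; 13; 0; 1; 10; 9; 4] d))
    (fun d => if d %/ 4 == v then Pre else if odd d then Over else Under)
    ord0.

(* A tangle with darts 'I_m.+1, whose boundary points (0, bottom), (0, top),
   (1, bottom), ... are the ends of the darts listed in [legs]; the entries of
   [opps] at these darts are not used. *)
Definition table_tangle (m n : nat) (rots opps : seq nat) (marks : seq strand)
    (legs : seq nat) : tangle n.+1 :=
  @Tangle n.+1 'I_m.+1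
    (fun d => inZp (nth 0 rots d))
    (fun d => if nat_of_ord d \in legs
              then let k := index (nat_of_ord d) legs in inr (inZp k./2, odd k)
              else inl (inZp (nth 0 opps d)))
    (fun d => nth Dot marks d)
    (fun l => inZp (nth 0 legs (l.1.*2 + l.2))).

Definition R2_braid (s : bool) : tangle 2 :=
  braid [tuple cross1 0 (Classical s); cross1 0 (Classical (~~ s))].

(* Removing the clasp leaves a dot inside each of the two remaining curls; a dot
   has to be taken out of a curl before R1 applies to it. *)
Section Unclasp.

Variables (O1 : tangle 2) (O2 O3 : tangle 1).
Variables (e1 : seq (tdart O1)) (e2 : seq (tdart O2)) (e3 : seq (tdart O3)).
Hypotheses (e1E : enumerates e1) (e2E : enumerates e2) (e3E : enumerates e3).
Variables (r1 : tdart O1) (r2 : tdart O2) (r3 : tdart O3).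
Variables (s1 s2 s3 : bool).

Let D1 := glue r1 (R2_braid s1).
Let D1' := glue r1 (trivial_braid 2).
Let D2 := glue r2 (kink (Classical s2)).
Let D2' := glue r2 (trivial_braid 1).
Let D3 := glue r3 (kink (Classical s3)).
Let D3' := glue r3 (trivial_braid 1).

Variables (d2 : dart D2) (d3 : dart D3).

Variables (D : plane_map) (e : seq (dart D)).
Hypothesis eE : enumerates e.
Variables (p1 p2 p3 : seq nat).

Let E1 : seq (dart D1) := sums e1 (braid_darts 1 1).
Let E1' : seq (dart D1') := sums e1 (braid_darts 0 1).
Let E2 : seq (dart D2) := sums e2 kink_darts.
Let E2s : seq (dart (subdivide d2)) := sums E2 bools.
Let E2' : seq (dart D2') := sums e2 (braid_darts 0 0).
Let E3 : seq (dart D3) := sums e3 kink_darts.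
Let E3s : seq (dart (subdivide d3)) := sums E3 bools.
Let E3' : seq (dart D3') := sums e3 (braid_darts 0 0).

(** [p1], [p2], [p3] describe the isotopies that put the diagram in the glued form required by the
    R2 move, then by each dot removal and R1 move. *)
Definition R2_R1_R1_check : bool :=
  [&& [&& pseudodiagram_check e, pseudodiagram_check E1 & pseudodiagram_check E1'],
      [&& pseudodiagram_check E2, pseudodiagram_check E2s & pseudodiagram_check E2'],
      [&& pseudodiagram_check E3, pseudodiagram_check E3s & pseudodiagram_check E3']
    & [&& map_iso_check e E1 p1, map_iso_check E1' E2s p2
        & map_iso_check E2' E3s p3]].

Lemma same_knot_R2_R1_R1 : R2_R1_R1_check -> same_knot D D3'.
Proof.
case/and4P=> /and3P[ce c1 c1'] /and3P[c2 c2s c2'] /and3P[c3 c3s c3'] /and3P[i1 i2 i3].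
have E1E : enumerates E1 by apply: sums_enum => //; apply: braid_darts_enum.
have E1'E : enumerates E1' by apply: sums_enum => //; apply: braid_darts_enum.
have E2E : enumerates E2 by apply: sums_enum => //; apply: kink_darts_enum.
have E2sE : enumerates E2s by apply: sums_enum => //; apply: bools_enum.
have E2'E : enumerates E2' by apply: sums_enum => //; apply: braid_darts_enum.
have E3E : enumerates E3 by apply: sums_enum => //; apply: kink_darts_enum.
have E3sE : enumerates E3s by apply: sums_enum => //; apply: bools_enum.
have E3'E : enumerates E3' by apply: sums_enum => //; apply: braid_darts_enum.
apply: rst_trans (same_knot_iso eE E1E ce c1 i1) _.
apply: rst_trans (same_knot_move E1E E1'E (R2 s1) c1 c1') _.
apply: rst_trans (same_knot_iso E1'E E2sE c1' c2s i2) _.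
apply: rst_trans (same_knot_subdivide E2E E2sE c2 c2s) _.
apply: rst_trans (same_knot_move E2E E2'E (R1 s2) c2 c2') _.
apply: rst_trans (same_knot_iso E2'E E3sE c2' c3s i3) _.
apply: rst_trans (same_knot_subdivide E3E E3sE c3 c3s) _.
exact: same_knot_move E3E E3'E (R1 s3) c3 c3'.
Qed.

End Unclasp.

(** * Unknotting one resolution of each diagram *)

Definition pre_dart (v : nat) : 'I_16 := inZp (4 * v).

Definition crossing_marks (k : nat) : seq strand :=
  flatten (nseq k [:: Under; Over; Under; Over]).

Definition two_crossings (opps legs : seq nat) : tangle 2 :=
  table_tangle 7 1 [:: 1; 2; 3; 0; 5; 6; 7; 4] opps (crossing_marks 2) legs.

(** The outside of the first curl to be undone: the other crossing, with a dot on its own curl. *)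
Definition crossing_dot (opps legs : seq nat) : tangle 1 :=
  table_tangle 5 0 [:: 1; 2; 3; 0; 5; 4] opps (crossing_marks 1) legs.

Definition dot_arc : tangle 1 := table_tangle 1 0 [:: 1; 0] [::] [::] [:: 1; 0].

Definition circle (r : nat) : plane_map :=
  @glue 1 dot_arc (inZp r : tdart dot_arc) (trivial_braid 1).

(** In the figure-eight diagram the dart [4 * v] is an under end, so [Over] is the resolution in
    which this crossing is changed. *)
Definition unknot (v : nat) : plane_map :=
  remark (set_mark (P := fig8 v) (pre_dart v) Over).

Lemma unknot0_circle : same_knot (unknot 0) (circle 0).
Proof.
(* Crossings 0 and 1 form the clasp; [O1] contains crossings 2 and 3. *)
pose O1 := two_crossings [:: 0; 6; 5; 0; 0; 2; 1; 0] [:: 3; 0; 4; 7].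
pose O2 := crossing_dot [:: 5; 0; 0; 4; 3; 0] [:: 1; 2].
(* [d2] and [d3] lie on the loop of the curl, which joins the two right corners; the end chosen
   fixes how the darts of the new dot are labelled in the isotopies. *)
pose d2 : dart (@glue 1 O2 ord0 (kink (Classical false))) := inr (true, true).
pose d3 : dart (@glue 1 dot_arc (inZp 0) (kink (Classical false))) := inr (true, false).
apply: (@same_knot_R2_R1_R1 O1 O2 dot_arc (ords 7) (ords 5) (ords 1)
  (@ords_enum 7) (@ords_enum 5) (@ords_enum 1) ord0 ord0 (inZp 0)
  true false false d2 d3 (unknot 0) (ords 15) (@ords_enum 15)
  [:: 8; 10; 11; 9; 15; 13; 12; 14; 0; 1; 2; 3; 4; 5; 6; 7]
  [:: 0; 1; 2; 3; 9; 7; 6; 8; 4; 5; 10; 11]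
  [:: 2; 4; 5; 3; 0; 1; 6; 7]).
by vm_compute.
Qed.

Lemma unknot2_circle : same_knot (unknot 2) (circle 1).
Proof.
(* Here crossings 2 and 3 form the clasp, and [O1] contains crossings 0 and 1. *)
pose O1 := two_crossings [:: 0; 0; 7; 6; 0; 0; 3; 2] [:: 4; 5; 1; 0].
pose O2 := crossing_dot [:: 5; 4; 0; 0; 1; 0] [:: 2; 3].
pose d2 : dart (@glue 1 O2 ord0 (kink (Classical true))) := inr (true, false).
pose d3 : dart (@glue 1 dot_arc (inZp 1) (kink (Classical true))) := inr (true, true).
apply: (@same_knot_R2_R1_R1 O1 O2 dot_arc (ords 7) (ords 5) (ords 1)
  (@ords_enum 7) (@ords_enum 5) (@ords_enum 1) ord0 ord0 (inZp 1)
  true true true d2 d3 (unknot 2) (ords 15) (@ords_enum 15)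
  [:: 0; 1; 2; 3; 4; 5; 6; 7; 13; 12; 14; 15; 10; 11; 9; 8]
  [:: 0; 1; 2; 3; 8; 9; 7; 6; 10; 11; 4; 5]
  [:: 4; 5; 3; 2; 6; 7; 0; 1]).
by vm_compute.
Qed.

(** Exchanging the two ends of each dot exchanges the two faces of the circle, hence the two choices
    of outer face. *)
Lemma circle0_circle1 : same_knot (circle 0) (circle 1).
Proof.
have E (r : nat) : enumerates (sums (ords 1) (braid_darts 0 0) : seq (dart (circle r))).
  by apply: sums_enum; [apply: ords_enum | apply: braid_darts_enum].
by apply: (same_knot_iso (E 0) (E 1) (p := [:: 1; 0; 3; 2])); vm_compute.
Qed.

Lemma fig8_pseudodiagram (v : nat) : v \in [:: 0; 2] -> pseudodiagram (fig8 v).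
Proof.
by rewrite !inE => /orP[] /eqP ->;
  apply: (pseudodiagramP (s := ords 15 : seq (dart (fig8 _))) (@ords_enum 15));
  vm_compute.
Qed.

Lemma fig8_resolutions (v : nat) : v \in [:: 0; 2] ->
  resolutions (fig8 v) =
    [set finfun (set_mark (P := fig8 v) (pre_dart v) Over);
         finfun (set_mark (P := fig8 v) (pre_dart v) Under)].
Proof.
by rewrite !inE => /orP[] /eqP ->;
  apply: (resolutions_single (s := ords 15 : seq (dart (fig8 _))) (@ords_enum 15));
  vm_compute.
Qed.

(** Both resolutions restore the figure-eight diagram with the same labels, so the isotopy is the
    identity. *)
Lemma fig8_resolve_under :
  same_knot (remark (set_mark (P := fig8 0) (pre_dart 0) Under))
            (remark (set_mark (P := fig8 2) (pre_dart 2) Under)).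
Proof.
have E v f : enumerates (ords 15 : seq (dart (@remark (fig8 v) f))).
  exact: ords_enum.
by apply: (same_knot_iso (E 0 _) (E 2 _) (p := iota 0 16)); vm_compute.
Qed.

Lemma fig8_wereset : signed_wereset (fig8 0) = signed_wereset (fig8 2).
Proof.
have P0 : mark (pre_dart 0 : dart (fig8 0)) = Pre by [].
have P2 : mark (pre_dart 2 : dart (fig8 2)) = Pre by [].
apply: (signed_wereset_pair (fig8_resolutions _) (set_mark_neq P0)
  (fig8_resolutions _) (set_mark_neq P2)) => //.
  rewrite !resolve_finfun; apply: knot_type_eq; apply: rst_trans unknot0_circle _.
  apply: rst_trans circle0_circle1 _; exact: rst_sym unknot2_circle.
by rewrite !resolve_finfun; apply: knot_type_eq; apply: fig8_resolve_under.
Qed.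

(** * Colorings modulo 13 *)

Local Open Scope ring_scope.

Lemma sqrtN1_F13 : 5 * 5 = -1 :> 'F_13.
Proof. by apply/eqP; vm_compute. Qed.

Lemma fig8_0_colorable : colorable (5 : 'F_13) (fig8 0).
Proof.
(* A solution of the coloring relations, normalized to 0 and 1 at the first two corners of the
   precrossing; it exists because [3 + 2 * 5] vanishes modulo 13. *)
pose c (d : dart (fig8 0)) : 'F_13 :=
  (nth 0 [:: 0; 1; 6; 5; 7; 6; 5; 6; 6; 0; 7; 0; 1; 7; 0; 7] d)%:R.
pose ok d := (c (opp d) == c d) &&
  match mark d with
  | Over => (c (vrot (vrot d)) == c d) &&
            (c (vrot d) + c (vrot (vrot (vrot d))) == c d + c d)
  | Under => true
  | Pre => (c (vrot (vrot d)) == c d + (1 + 5) * (c (vrot d) - c d)) &&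
           (c (vrot (vrot (vrot d))) == c d + 5 * (c (vrot d) - c d))
  | Dot => c (vrot d) == c d
  end.
have /allP okE : all ok (ords 15) by vm_compute.
exists c; split=> [d|].
  have /andP[/eqP -> vd] := okE d (ords_enum d); split=> //.
  move: vd; rewrite /vcol; case: (mark d) => //; last by move/eqP.
    by case/andP => /eqP -> /eqP ->.
  by case/andP => /eqP -> /eqP ->.
by exists (inZp 0), (inZp 1); apply/eqP; vm_compute.
Qed.

Lemma fig8_2_not_colorable : ~ colorable (5 : 'F_13) (fig8 2).
Proof.
case=> c [cE [x [y cxy]]]; apply: cxy.
pose e (k : nat) := c (inZp k).
have edge (k l : nat) : opp (inZp k : dart (fig8 2)) == inZp l -> e l = e k.
  by move=> /eqP; rewrite /e => <-; case: (cE (inZp k)).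
have turn (k l m n : nat) :
    [&& vrot (inZp k : dart (fig8 2)) == inZp l,
        vrot (inZp l : dart (fig8 2)) == inZp m
      & vrot (inZp m : dart (fig8 2)) == inZp n] ->
    match mark (inZp k : dart (fig8 2)) with
    | Over => e m = e k /\ e l + e n = e k + e k
    | Pre => e m = e k + (1 + 5) * (e l - e k) /\ e n = e k + 5 * (e l - e k)
    | _ => True
    end.
  case/and3P=> /eqP kl /eqP lm /eqP mn; have [_] := cE (inZp k).
  by rewrite /vcol kl lm mn; case: (mark _).
(* The relations express every color through [e 8] and [e 9], at two adjacent corners of the
   precrossing. *)
have [e3 sum1] : e 3 = e 1 /\ e 2 + e 0 = e 1 + e 1 by apply: (turn 1 2 3 0).
have [e7 sum5] : e 7 = e 5 /\ e 6 + e 4 = e 5 + e 5 by apply: (turn 5 6 7 4).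
have [e15 _] : e 15 = e 13 /\ e 14 + e 12 = e 13 + e 13.
  by apply: (turn 13 14 15 12).
have [e10 e11] : e 10 = e 8 + (1 + 5) * (e 9 - e 8) /\ e 11 = e 8 + 5 * (e 9 - e 8).
  by apply: (turn 8 9 10 11).
have e0 : e 0 = e 11 by apply: edge.
have e12 : e 12 = e 1 by apply: edge.
have e2 : e 2 = e 7 by apply: edge.
have e6 : e 6 = e 3 by apply: edge.
have e4 : e 4 = e 15 by apply: edge.
have e5 : e 5 = e 8 by apply: edge.
have e14 : e 14 = e 9 by apply: edge.
have e13 : e 13 = e 10 by apply: edge.
move: sum1 sum5; rewrite e2 e7 e5 e0 e6 e3 e4 e15 e13 => sum1 sum5.
have e1 : e 1 = e 8 - 6 * (e 9 - e 8).
  by rewrite -[e 1](addrK (e 10)) sum5 e10; ring.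
have e9 : e 9 = e 8.
  (* The factor [17] is the determinant [2 + 3 * i] at [i = 5], which is nonzero modulo 13. *)
  apply/eqP; rewrite -subr_eq0; have /eqP : 17 * (e 9 - e 8) = 0.
    by rewrite -(subrr (e 1 + e 1)) -{1}sum1 e1 e11; ring.
  by rewrite mulf_eq0.
rewrite e9 subrr mulr0 subr0 in e1.
have eE d : c d = e 8.
  have := ords_enum d; rewrite /ords /= !inE.
  by do 15?[case/orP => [/eqP -> |]]; last move/eqP ->; rewrite -/(e _)
    ?(e0, e2, e3, e4, e5, e6, e7, e10, e11, e12, e13, e14, e15, e1, e9)
    ?subrr ?mulr0 ?addr0.
by rewrite !eE.
Qed.

Theorem theorem2 :
  exists P1 P2 : plane_map,
    [/\ pseudodiagram P1, pseudodiagram P2,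
        ~ same_pseudoknot P1 P2
      & signed_wereset P1 = signed_wereset P2].
Proof.
exists (fig8 0), (fig8 2); split; [exact: fig8_pseudodiagram |
  exact: fig8_pseudodiagram | | exact: fig8_wereset].
move=> /(colorable_pseudoknot sqrtN1_F13) [H _].
exact: fig8_2_not_colorable (H fig8_0_colorable).
Qed.
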